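(* There is an absolute constant $c$ such that, for every adaptive FMM tree with $N$ particles in $[0,1]^3$ (either the adaptive octree of the particles or its extended octree), the number of M2L operations is at most $cN$; that is, the number of M2L operations is $\mathcal{O}(N)$.
   Context: **Adaptive octree.** Given particles $x_1,\dots,x_N\in[0,1]^3$, $N\ge1$, and an integer threshold $t\ge1$, the root corresponds to the closed cube $[0,1]^3$ and has depth $0$. A node containing more than $t$ particles is subdivided into its $8$ congruent closed sub-cubes; only children containing particles are kept. A node with at most $t$ particles is a leaf. A particle on a dividing midplane is assigned to the left (lower-coordinate) child, so each particle in a node belongs to exactly one child. The tree is assumed finite (automatic if the particles are distinct). $\mathcal{I}(M)$ is the closed cube of node $M$, $\delta(M)$ its depth, $\mathcal{P}(M)$ its parent. **Extended octree.** Let $l_{\max}$ be the depth of the adaptive octree. The extended octree is obtained by adding, for every non-leaf node, all its missing (empty) children, and then repeatedly subdividing every leaf (occupied or empty) of depth less than $l_{\max}$ into $8$ children until all leaves are at depth $l_{\max}$. A node is occupied if it contains at least one particle and empty otherwise. **M2L operations.** The vicinity $\mathcal{V}(C)$ is the union of the $26$ cubes of the same size as $\mathcal{I}(C)$ in the same grid that touch $\mathcal{I}(C)$ and differ from it. A node $\alpha$ is separated from $C$ if the interior of $\mathcal{I}(\alpha)$ meets the interior of $\mathcal{V}(\mathcal{P}(C))$ and does not meet the interior of $\mathcal{V}(C)$. A node $\alpha$ is well-separated from $C$ if it is separated from $C$ and $\delta(\alpha)\le\delta(C)$. (Nothing is separated from the root.) $\alpha\in$ V-List$(C)$ iff $\alpha$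 and $C$ are well-separated from each other (in particular they then have the same depth). An M2L operation is a pair of occupied nodes $\{\alpha,C\}$ with $\alpha\in$ V-List$(C)$. *)

(* Defs.v *)
From HB Require Import structures.
From mathcomp Require Import all_boot all_order all_algebra.
From mathcomp Require Import finmap.
From mathcomp Require Import all_classical all_reals all_analysis.

Set Implicit Arguments.
Unset Strict Implicit.
Unset Printing Implicit Defensive.

Import Order.TTheory GRing.Theory Num.Theory.
Import numFieldNormedType.Exports.

Local Open Scope classical_set_scope.
Local Open Scope ring_scope.

(* The cell (d, k) is the cube of side 2^-d with lowest corner 2^-d k.  The
   index k ranges over all of Z^3, so that the grid of a given depth covers the
   whole space and every cell has 26 neighbours, also at the boundary of
   [0,1]^3. *)
Definition cell : Type := (nat * 'rV[int]_3)%type.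

Definition depth (M : cell) : nat := M.1.

Definition root_cell : cell := (0%N, 0).

Definition cube (R : realType) (M : cell) : set 'rV[R]_3 :=
  [set y | forall i : 'I_3,
     (M.2 0 i)%:~R / 2 ^+ depth M <= y 0 i <= (M.2 0 i + 1)%:~R / 2 ^+ depth M].

Arguments cube R M : clear implicits.

(* b i tells whether the sub-cube is the upper one in direction i. *)
Definition child (M : cell) (b : {ffun 'I_3 -> bool}) : cell :=
  ((depth M).+1, \row_i (2 * M.2 0 i + (b i)%:Z)).

Definition is_child (C M : cell) : Prop :=
  exists b : {ffun 'I_3 -> bool}, C = child M b.

(* Division in int rounds down here, so parent (child M b) = M; the value at
   cells of depth 0 is irrelevant. *)
Definition parent (C : cell) : cell :=
  ((depth C).-1, \row_i divz (C.2 0 i) 2).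

Definition midplane (R : realType) (M : cell) (i : 'I_3) : R :=
  (2 * M.2 0 i + 1)%:~R / 2 ^+ (depth M).+1.

(* The cell of depth d to which the point y of [0,1]^3 is assigned; a point on
   a dividing midplane goes to the lower child. *)
Fixpoint cell_at (R : realType) (y : 'rV[R]_3) (d : nat) : cell :=
  if d is d'.+1 then
    let M := cell_at y d' in child M [ffun i => midplane R M i < y 0 i]
  else root_cell.

Section Trees.
Variables (R : realType) (N : nat) (x : 'I_N -> 'rV[R]_3) (t : nat).

(* Membership is by assignment: a particle lying on a face of cube R M need not
   belong to M. *)
Definition particles (M : cell) : {set 'I_N} :=
  [set j | cell_at (x j) (depth M) == M].

Definition occupied (M : cell) : Prop := (0 < #|particles M|)%N.

Inductive adaptive_octree : set cell :=
| adaptive_root : adaptive_octree root_cell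
| adaptive_child M C :
    adaptive_octree M -> (t < #|particles M|)%N ->
    is_child C M -> occupied C -> adaptive_octree C.

(* Meaningful for finite T only. *)
Definition tree_depth (T : set cell) : nat :=
  (\max_(M <- fset_set T) depth M)%N.

(* In extended_subdivide, M need not be required to be a leaf, as a node that
   has already been subdivided has all its children by then. *)
Inductive extended_octree : set cell :=
| extended_adaptive M : adaptive_octree M -> extended_octree M
| extended_missing M C :
    adaptive_octree M -> (t < #|particles M|)%N ->
    is_child C M -> extended_octree C
| extended_subdivide M C :
    extended_octree M -> (depth M < tree_depth adaptive_octree)%N ->
    is_child C M -> extended_octree C.

End Trees.

Definition vicinity (R : realType) (C : cell) : set 'rV[R]_3 :=
  \bigcup_(D in [set D : cell | [/\ depth D = depth C, D <> C &
                                    cube R D `&` cube R C !=set0]]) cube R D.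

Arguments vicinity R C : clear implicits.

Definition separated_from (R : realType) (a C : cell) : Prop :=
  [/\ (0 < depth C)%N,
      (cube R a)° `&` (vicinity R (parent C))° !=set0 &
      ~ ((cube R a)° `&` (vicinity R C)° !=set0)].

Definition well_separated (R : realType) (a C : cell) : Prop :=
  separated_from R a C /\ (depth a <= depth C)%N.

Definition V_list (R : realType) (T : set cell) (C : cell) : set cell :=
  [set a | [/\ T a, well_separated R a C & well_separated R C a]].

(* Operations are unordered pairs, hence two-element sets of cells. *)
Definition M2L_operations (R : realType) (N : nat) (x : 'I_N -> 'rV[R]_3)
    (T : set cell) : set (set cell) :=
  [set p | exists a C : cell,
     [/\ T C, occupied x a, occupied x C, V_list R T C a & p = [set a; C]]].

(* Main.v *)
(** Call a particle the leader of its cell at depth d if it has the least index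
    there; a leader stays a leader at all greater depths, so it has a first
    depth ("birth") at which it leads.  An M2L pair at depth d is given by the
    leaders j, k of its two cells, and d is determined by (j, k): it is the
    first depth at which the cells of j and k no longer touch.  Let e <= d be
    the later of the two births, say that of j.  At depth e the cells of j and k
    differ by at most 3 in every coordinate, and k is the leader of its cell
    there, so k is determined by j and one of 7^3 offsets.  Hence there are at
    most 7^3 N operations. *)
Require Import Defs.
From HB Require Import structures.
From mathcomp Require Import all_boot all_order all_algebra.
From mathcomp Require Import all_classical all_reals all_analysis.
From mathcomp Require Import zify.

Set Implicit Arguments.
Unset Strict Implicit.
Unset Printing Implicit Defensive.

Import Order.TTheory GRing.Theory Num.Theory.
Import numFieldNormedType.Exports.

Local Open Scope classical_set_scope.
Local Open Scope card_scope.
Local Open Scope ring_scope.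

(** * Distances between cell indices *)

(** Sup-norm distance of the indices; depths are not compared. For cells of equal depth, radius 1
    means that the closed cubes touch or coincide. *)
Definition within (r : int) (a C : cell) : bool :=
  [forall i : 'I_3, `|a.2 0 i - C.2 0 i| <= r].

Lemma withinP (r : int) (a C : cell) :
  reflect (forall i, `|a.2 0 i - C.2 0 i| <= r) (within r a C).
Proof. exact: forallP. Qed.

Lemma within_sym (r : int) (a C : cell) : within r a C = within r C a.
Proof. by apply/eq_forallb => i; rewrite distrC. Qed.

Lemma within_parent (a C : cell) :
  within 1 a C -> within 1 (parent a) (parent C).
Proof.
by move=> /withinP near; apply/withinP => i; move: (near i); rewrite !mxE; lia.
Qed.

(** An index is twice that of the parent plus 0 or 1, so a gap of 1 between parents grows to at most
    2 + 1. *)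
Lemma parent_within (a C : cell) :
  within 1 (parent a) (parent C) -> within 3 a C.
Proof.
by move=> /withinP near; apply/withinP => i; move: (near i); rewrite !mxE; lia.
Qed.

Lemma within_le (r s : int) (a C : cell) :
  r <= s -> within r a C -> within s a C.
Proof.
by move=> rs /withinP near; apply/withinP => i; apply: le_trans (near i) rs.
Qed.

Lemma cell_eqP (a C : cell) :
  depth a = depth C -> (forall i, a.2 0 i = C.2 0 i) -> a = C.
Proof.
case: a C => [d k] [e l] /= -> kl; congr pair.
by apply/rowP.
Qed.

Lemma parent_child (M : cell) (b : {ffun 'I_3 -> bool}) :
  parent (child M b) = M.
Proof. by apply: cell_eqP => // i; rewrite !mxE; case: (b i); lia. Qed.

(** * Cubes, their interiors and separation, in terms of indices *)

Section Geometry.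
Variable R : realType.

Lemma interior_cube_lt (M : cell) (y : 'rV[R]_3) (i : 'I_3) :
  (cube R M)° y ->
  (M.2 0 i)%:~R / 2 ^+ depth M < y 0 i < (M.2 0 i + 1)%:~R / 2 ^+ depth M.
Proof.
move=> /nbhs_ballP[e /= e0 ballM].
have e20 : 0 < e / 2 by rewrite divr_gt0.
(* Balls are those of the sup norm, so all coordinates can be shifted at once; shifts by [e / 2]
   both ways make the bounds strict. *)
have inball (z : R) : `|z| < e -> cube R M (y - const_mx z).
  move=> ze; apply: ballM; split=> // j k.
  by rewrite !mxE /ball /= opprB addrC subrK.
have lte : `|e / 2| < e by rewrite gtr0_norm // ltr_pdivrMr // ltr_pMr // ltr1n.
have /(_ i) := inball _ lte.
have /(_ i) : cube R M (y - const_mx (- (e / 2))) by apply: inball; rewrite normrN.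
rewrite !mxE opprK => /andP[_ up] /andP[lo _]; apply/andP; split.
  by apply: le_lt_trans lo _; rewrite ltrBlDr ltrDl.
by apply: lt_le_trans up; rewrite ltrDl.
Qed.

Lemma meet_within (D C : cell) :
  depth D = depth C -> cube R D `&` cube R C !=set0 -> within 1 D C.
Proof.
move=> DC [y [yD yC]]; apply/withinP => i.
have /andP[loD upD] := yD i; have /andP[loC upC] := yC i.
have p0 : 0 < (2 ^+ depth C : R) by rewrite exprn_gt0.
have := le_trans loD upC; have := le_trans loC upD.
rewrite DC !ler_pM2r ?invr_gt0 // !ler_int.
by lia.
Qed.

Lemma within_meet (D C : cell) :
  depth D = depth C -> within 1 D C -> cube R D `&` cube R C !=set0.
Proof.
move=> DC /withinP near.
(* In each coordinate the larger of the two lower ends lies in both intervals, as the indices differ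
   by at most 1. *)
exists (\row_i ((Order.max (D.2 0 i) (C.2 0 i))%:~R / 2 ^+ depth C)).
have p0 : 0 < (2 ^+ depth C : R) by rewrite exprn_gt0.
split=> i; rewrite mxE ?DC !ler_pM2r ?invr_gt0 // !ler_int; move: (near i); lia.
Qed.

(** For indices [m] of [a] and [n] of [D], the strict bounds on [y] give [m < 2 (n + 1)] and
    [2 n < m + 1], so [n] is [m / 2] rounded down. *)
Lemma interior_cube_parent (a D : cell) (y : 'rV[R]_3) :
  depth a = (depth D).+1 -> (cube R a)° y -> cube R D y -> parent a = D.
Proof.
move=> aD ya yD; apply: cell_eqP; first by rewrite /parent /depth /= -/(depth a) aD.
move=> i; rewrite mxE.
have /andP[lo up] := interior_cube_lt i ya; have /andP[loD upD] := yD i.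
have p0 : 0 < (2 ^+ depth D : R) by rewrite exprn_gt0.
have := le_lt_trans loD up; have := lt_le_trans lo upD.
rewrite aD exprS invfM !mulrA !ltr_pM2r ?invr_gt0 //.
rewrite ltr_pdivrMr // ltr_pdivlMr // -!(intrM _ _ 2) !ltr_int.
by lia.
Qed.

Lemma separated_from_parent (a C : cell) :
  depth a = depth C -> separated_from R a C ->
  [/\ (0 < depth C)%N, within 1 (parent a) (parent C) & ~~ within 1 a C].
Proof.
move=> aC [C0 [y [ya /interior_subset[D /= [DC DneC DmC] yD]]] far].
(* As [y] is interior to [a], the neighbour of [parent C] containing it can only be [parent a]. *)
have parentaD : parent a = D.
  by apply: interior_cube_parent ya yD; rewrite DC aC prednK.
split=> //; first by rewrite parentaD; apply: meet_within.
(* Otherwise [a], which differs from [C] because their parents differ, would be one of the cubes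
   forming the vicinity of [C]. *)
apply/negP => near; apply: far; exists y; split=> //.
apply: interiorS ya => z za; exists a => //; split=> //.
  by move=> eqaC; apply: DneC; rewrite -parentaD eqaC.
exact: within_meet.
Qed.

(** * The depth at which the cells of two points cease to touch *)

Lemma parent_cell_at (y : 'rV[R]_3) (d : nat) :
  parent (cell_at y d.+1) = cell_at y d.
Proof. exact: parent_child. Qed.

Lemma depth_cell_at (y : 'rV[R]_3) (d : nat) : depth (cell_at y d) = d.
Proof. by elim: d => //= d; rewrite /depth /= => ->. Qed.

Lemma within_cell_at_anti (y z : 'rV[R]_3) (d e : nat) : (d <= e)%N ->
  within 1 (cell_at y e) (cell_at z e) -> within 1 (cell_at y d) (cell_at z d).
Proof.
elim: e => [|e IH]; first by rewrite leqn0 => /eqP ->.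
rewrite leq_eqVlt => /predU1P[-> //|le_de] /within_parent.
by rewrite !parent_cell_at; apply: IH.
Qed.

Definition splits_at (y z : 'rV[R]_3) (d : nat) : Prop :=
  [/\ (0 < d)%N, within 1 (cell_at y d.-1) (cell_at z d.-1) &
      ~~ within 1 (cell_at y d) (cell_at z d)].

Lemma splits_at_sym (y z : 'rV[R]_3) (d : nat) :
  splits_at y z d -> splits_at z y d.
Proof. by rewrite /splits_at !(within_sym _ (cell_at y _)). Qed.

Lemma splits_at_leq (y z : 'rV[R]_3) (d e : nat) :
  splits_at y z d -> splits_at y z e -> (e <= d)%N.
Proof.
move=> [d0 _ fard] [e0 neare _]; rewrite leqNgt; apply: contra fard => lt_de.
by apply: within_cell_at_anti neare; rewrite -ltnS prednK.
Qed.

Lemma splits_at_inj (y z : 'rV[R]_3) (d e : nat) :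
  splits_at y z d -> splits_at y z e -> d = e.
Proof.
by move=> yd ye; apply/eqP; rewrite eqn_leq !(splits_at_leq yd, splits_at_leq ye).
Qed.

(** Before depth [d] the cells still touch; at [d] itself only their parents do, which costs the
    bound 3. *)
Lemma splits_at_within3 (y z : 'rV[R]_3) (d e : nat) : (e <= d)%N ->
  splits_at y z d -> within 3 (cell_at y e) (cell_at z e).
Proof.
rewrite leq_eqVlt => /predU1P[->|lt_ed] [d0 near _].
  by apply: parent_within; rewrite -(prednK d0) !parent_cell_at.
apply: (@within_le 1) => //; apply: within_cell_at_anti near.
by rewrite -ltnS prednK.
Qed.

End Geometry.

(** * Leaders of cells and the coding of operations *)

Section Leaders.
Variables (R : realType) (N : nat) (x : 'I_N -> 'rV[R]_3).

Definition leader (d : nat) (j : 'I_N) : bool :=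
  [forall k, (cell_at (x k) d == cell_at (x j) d) ==> (j <= k)%N].

Lemma leaderP (d : nat) (j : 'I_N) :
  reflect (forall k, cell_at (x k) d = cell_at (x j) d -> (j <= k)%N)
          (leader d j).
Proof.
apply: (iffP forallP) => [H k /eqP|H k]; first by move: (H k) => /implyP.
by apply/implyP => /eqP/H.
Qed.

(** Particles sharing a cell at depth [e] already share one at depth [d], so the competitors of [j]
    only become fewer. *)
Lemma leader_mono (d e : nat) (j : 'I_N) :
  (d <= e)%N -> leader d j -> leader e j.
Proof.
elim: e => [|e IH]; first by rewrite leqn0 => /eqP ->.
rewrite leq_eqVlt => /predU1P[-> //|le_de] /(IH le_de)/leaderP lead.
apply/leaderP => k eqc; apply: lead.
by rewrite -[LHS]parent_cell_at eqc parent_cell_at.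
Qed.

Lemma leader_inj (d : nat) (j k : 'I_N) :
  leader d j -> leader d k -> cell_at (x j) d = cell_at (x k) d -> j = k.
Proof.
move=> /leaderP lj /leaderP lk jk; apply/val_inj/eqP.
by rewrite eqn_leq lj // lk.
Qed.

Lemma occupied_leader (M : cell) :
  occupied x M -> exists2 j, leader (depth M) j & cell_at (x j) (depth M) = M.
Proof.
rewrite /occupied card_gt0 => /set0Pn[j0]; rewrite inE => j0M.
case: (@arg_minnP _ j0 (fun j => cell_at (x j) (depth M) == M)
  (@nat_of_ord N) j0M) => j /eqP jM jmin.
exists j => //; apply/leaderP => k kj.
by apply: jmin; rewrite kj jM.
Qed.

(* u.1 is the leader born last, e is its birth depth, and u.2 is the offset at
   depth e, shifted from [-3, 3] to [0, 6]. *)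
Definition code (p : set cell) (u : 'I_N * {ffun 'I_3 -> 'I_7}) : Prop :=
  exists k d e,
    [/\ leader e u.1 /\ (forall e', leader e' u.1 -> (e <= e')%N),
        leader e k,
        forall i, (u.2 i)%:Z =
          (cell_at (x k) e).2 0 i - (cell_at (x u.1) e).2 0 i + 3,
        splits_at (x u.1) (x k) d &
        p = [set cell_at (x u.1) d; cell_at (x k) d]].

(** Minimality fixes [e], the offset then fixes the cell of [k] at depth [e] and so its leader [k],
    and the pair fixes [d]. *)
Lemma code_inj (p q : set cell) u : code p u -> code q u -> p = q.
Proof.
case: u => j o [k [d [e [[/= lj minj] lk ok sk ->]]]].
move=> [k' [d' [e' [[/= lj' minj'] lk' ok' sk' ->]]]].
have ee' : e = e' by apply/eqP; rewrite eqn_leq minj // minj'.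
move: lk' ok'; rewrite -ee' => lk' ok'.
have kk' : k = k'.
  apply: leader_inj lk lk' _; apply: cell_eqP; first by rewrite !depth_cell_at.
  by move=> i; move: (ok i); rewrite ok'; lia.
move: sk'; rewrite -kk' => sk'.
by rewrite (splits_at_inj sk sk').
Qed.

Lemma splits_at_code (j k : 'I_N) (d e : nat) :
  leader e j -> (forall e', leader e' j -> (e <= e')%N) -> leader e k ->
  (e <= d)%N -> splits_at (x j) (x k) d ->
  exists u, code [set cell_at (x j) d; cell_at (x k) d] u.
Proof.
move=> lj minj lk ed jk.
have /withinP near := splits_at_within3 ed jk.
(* The shifted offset lies in [0, 6], so neither [absz] nor [inord] alters it. *)
exists (j, [ffun i => inord
  (absz ((cell_at (x k) e).2 0 i - (cell_at (x j) e).2 0 i + 3)%R)]).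
exists k, d, e; split=> //= i.
by rewrite ffunE inordK; move: (near i); lia.
Qed.

Lemma M2L_code (T : set cell) (p : set cell) :
  M2L_operations x T p -> exists u, code p u.
Proof.
move=> [a [C [_ occa occC [_ [sepaC aC] [sepCa Ca]] ->]]].
have eqd : depth a = depth C by apply/eqP; rewrite eqn_leq aC.
have [C0 nearP farC] := separated_from_parent eqd sepaC.
have [j lj ja] := occupied_leader occa; have [k lk kC] := occupied_leader occC.
rewrite eqd in lj ja; set d := depth C in lj ja lk kC C0.
have jk : splits_at (x j) (x k) d.
  split; rewrite ?ja ?kC //.
  by rewrite -!(parent_cell_at _ d.-1) prednK // ja kC.
rewrite -ja -kC.
have [e lje minj] := ex_minnP (ex_intro (leader ^~ j) d lj).
have [f lkf mink] := ex_minnP (ex_intro (leader ^~ k) d lk).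
case/orP: (leq_total f e) => fe.
  by apply: (splits_at_code lje) => //; [exact: leader_mono lkf|exact: minj].
(* Here [k] is born last; operations are unordered, so the roles can be swapped. *)
rewrite setUC; apply: (splits_at_code lkf) => //; last exact: splits_at_sym.
  exact: leader_mono lje.
exact: mink.
Qed.

End Leaders.

(** * Counting by codes *)

Lemma card_le_code (T : choiceType) (x0 : T) (U : finType) (A : set T)
    (r : T -> U -> Prop) :
  (forall p, A p -> exists u, r p u) ->
  (forall p q u, r p u -> r q u -> p = q) ->
  A #<= `I_#|U|.
Proof.
move=> rA r_inj.
(* Decoding: [n] goes to the element coded by the [n]-th member of [U], or to [x0] if there is none.
   The image covers [A]. *)
pose f n := xget x0 [set p | exists2 u, val (enum_rank u) = n & r p u].
apply: card_le_trans (card_image_le f `I_#|U|).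
apply: subset_card_le => p /rA[u pu].
exists (val (enum_rank u)); first exact: ltn_ord.
apply: xget_unique; first by exists u.
by move=> q [v /val_inj/enum_rank_inj -> qu]; apply: r_inj qu pu.
Qed.

Lemma M2L_operations_card (R : realType) (N : nat) (x : 'I_N -> 'rV[R]_3)
    (T : set cell) : M2L_operations x T #<= `I_(7 ^ 3 * N)%N.
Proof.
have -> : (7 ^ 3 * N)%N = #|{: 'I_N * {ffun 'I_3 -> 'I_7}}|.
  by rewrite card_prod card_ffun !card_ord mulnC.
apply: (card_le_code set0 (@M2L_code R N x T)) => p q u; exact: code_inj.
Qed.

Theorem lemma5 :
  exists c : nat,
    forall (R : realType) (N t : nat) (x : 'I_N -> 'rV[R]_3),
      (1 <= N)%N -> (1 <= t)%N ->
      (forall (j : 'I_N) (i : 'I_3), 0 <= x j 0 i <= 1) ->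
      finite_set (adaptive_octree x t) ->
      (M2L_operations x (adaptive_octree x t) #<= `I_(c * N)%N) /\
      (M2L_operations x (extended_octree x t) #<= `I_(c * N)%N).
Proof.
by exists (7 ^ 3)%N => R N t x _ _ _ _; split; apply: M2L_operations_card.
Qed.
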